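(* Let $m\geq 2$ be an integer and let $p$ be an odd prime. (a) Let $(G,\{\rho_0,\rho_1,\rho_2\})$ be a non-degenerate string C-group of rank three and order $4p^m$ with Schläfli type $\{k_1,k_2\}$, and let $P$ be a Sylow $p$-subgroup of $G$. Then $P$ is abelian if and only if $(G,\{\rho_0,\rho_1,\rho_2\})$ is tight, that is, $|G|=2k_1k_2$. (b) Moreover, let $l_1,l_2$ be integers with $1\leq l_1\leq l_2$ and $l_1+l_2=m$. Then, up to duality and isomorphism, there is a unique string C-group of rank three, order $4p^m$ and type $\{2p^{l_1},p^{l_2}\}$. Its group is $$G=(\langle x\rangle\times\langle y\rangle)\rtimes\langle\rho_0,\rho_2\rangle=\langle\rho_0,\ \rho_1=xy\rho_2,\ \rho_2\rangle$$ $$=\langle x,y,\rho_0,\rho_2\mid x^{p^{l_2}},\,y^{p^{l_1}},\,\rho_0^2,\,\rho_2^2,\,[x,y],\,[\rho_0,\rho_2],\,x^{\rho_0}=x,\,x^{\rho_2}=x^{-1},\,y^{\rho_0}=y^{-1},\,y^{\rho_2}=y^{-1}\rangle,$$ with distinguished generators $\rho_0$, $\rho_1=xy\rho_2$, $\rho_2$, and $G\cong(C_{p^{l_1}}\times C_{p^{l_2}})\rtimes(C_2\times C_2)$.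
   Context: A string C-group of rank three is a pair $(G,\{\rho_0,\rho_1,\rho_2\})$ where $G$ is a group and $(\rho_0,\rho_1,\rho_2)$ is an ordered triple of distinct involutions of $G$ such that: $G=\langle\rho_0,\rho_1,\rho_2\rangle$; $\rho_0\rho_2=\rho_2\rho_0$ (string property); and for all $I,J\subseteq\{0,1,2\}$, $\langle\rho_i\mid i\in I\rangle\cap\langle\rho_j\mid j\in J\rangle=\langle\rho_k\mid k\in I\cap J\rangle$ (intersection property). Its order is $|G|$. Its Schläfli type (or type) is the ordered pair $\{k_1,k_2\}$ with $k_1=o(\rho_0\rho_1)$ and $k_2=o(\rho_1\rho_2)$, where $o(g)$ is the order of $g$. It is non-degenerate if $k_1\neq 2$ and $k_2\neq 2$. It is tight if $|G|=2k_1k_2$. The dual of $(G,\{\rho_0,\rho_1,\rho_2\})$ is $(G,\{\rho_2,\rho_1,\rho_0\})$, whose type is $\{k_2,k_1\}$. Two string C-groups $(G,\{\rho_0,\rho_1,\rho_2\})$ and $(G',\{\rho_0',\rho_1',\rho_2'\})$ are isomorphic if there is a group isomorphism $G\to G'$ with $\rho_i\mapsto\rho_i'$ for all $i$. ''Unique up to duality and isomorphism'' means that such a string C-group exists and that every string C-group of order $4p^m$ whose type is $\{2p^{l_1},p^{l_2}\}$ or the dual type $\{p^{l_2},2p^{l_1}\}$ is isomorphic to it or to its dual. Notation: $g^h=h^{-1}gh$, $[g,h]=g^{-1}h^{-1}gh$, and $C_n$ is the cyclic group of order $n$. *)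

(* Defs.v *)
From mathcomp Require Import all_boot all_fingroup all_solvable zmodp.

Set Implicit Arguments.
Unset Strict Implicit.
Unset Printing Implicit Defensive.

Local Open Scope group_scope.

Section StringCGroups.

Variables (gT : finGroupType) (G : {group gT}) (r0 r1 r2 : gT).

Definition gen_sub (I : {set 'I_3}) : {group gT} :=
  <<[set tnth [tuple r0; r1; r2] i | i in I]>>%G.

Definition involutions : Prop := [/\ #[r0] = 2, #[r1] = 2 & #[r2] = 2].

Definition string_property : Prop := r0 * r2 = r2 * r0.

Definition intersection_property : Prop :=
  forall I J : {set 'I_3}, gen_sub I :&: gen_sub J = gen_sub (I :&: J).

Definition string_C_group : Prop :=
  [/\ uniq [:: r0; r1; r2], involutions, <<[set r0; r1; r2]>> = G,
      string_property & intersection_property].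

Definition schlafli_type : nat * nat := (#[r0 * r1], #[r1 * r2]).

Definition non_degenerate : Prop :=
  schlafli_type.1 <> 2 /\ schlafli_type.2 <> 2.

Definition tight : Prop :=
  #|G| = (2 * schlafli_type.1 * schlafli_type.2)%N.

End StringCGroups.

Definition scg_iso (aT : finGroupType) (G : {group aT}) (r0 r1 r2 : aT)
    (rT : finGroupType) (H : {group rT}) (s0 s1 s2 : rT) : Prop :=
  exists f : {morphism G >-> rT},
    isom G H f /\ [/\ f r0 = s0, f r1 = s1 & f r2 = s2].

Definition relations (a b : nat) (H : groupType) (x y s0 s2 : H) : Prop :=
  [/\ x ^+ a = 1, y ^+ b = 1, s0 ^+ 2 = 1 & s2 ^+ 2 = 1] /\
  [/\ [~ x, y] = 1 & [~ s0, s2] = 1] /\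
  [/\ x ^ s0 = x, x ^ s2 = x^-1, y ^ s0 = y^-1 & y ^ s2 = y^-1].

(* G is the group presented by [relations], with x, y, s0, s2 the images of
   the generators of the free group.  The relation [\isog Grp] of MathComp
   leaves the generators anonymous and only sees finite quotients, so it does
   not express that these four elements are the presenting generators; hence
   the universal property is spelled out, over all groups H.  The values of f
   outside G are irrelevant. *)
Definition presented (a b : nat) (gT : finGroupType) (G : {group gT})
    (x y s0 s2 : gT) : Prop :=
  [/\ <<[set x; y; s0; s2]>> = G,
      relations a b x y s0 s2 &
      forall (H : groupType) (x' y' s0' s2' : H),
        relations a b x' y' s0' s2' ->
        exists f : gT -> H,
          {in G &, {morph f : u v / u * v}} /\
          [/\ f x = x', f y = y', f s0 = s0' & f s2 = s2']].

(* Main.v *)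
Require Import Defs.
From HB Require Import structures.
From mathcomp Require Import all_boot all_fingroup all_solvable zmodp.
From mathcomp Require Import ssralg zify.
Set Implicit Arguments.
Unset Strict Implicit.
Unset Printing Implicit Defensive.

Import GRing.Theory.
Local Open Scope group_scope.

(** Why the theorem holds.

    Let P be a Sylow p-subgroup of G, of odd order and index 4.  An involution
    fixes no coset of P, and two fixed-point-free involutions of a set of four
    points commute; as G is generated by involutions, G' lies in the core of P
    and P is normal ([odd_index4_normal]).  Hence G is the semidirect product
    of P by the Klein group <r0, r2>, and r1 is congruent modulo P to one of
    r2, r0 and r0 r2 ([generator_mod_cases]).

    Suppose that r1 = u r2 with u in P, and let v = (r0 r1)^2 = u^r0 u^-1.
    Then the type is {2 #[v], #[u]}, and the intersection property gives
    <u> :&: <v> = 1, so that G is tight exactly when P = <u><v>.  If P is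
    abelian then <u><v> is a subgroup invariant under G, so it is all of P.
    Conversely, r1 inverts both u and v, and a nilpotent group of odd order
    P = <u><v> with such an automorphism is abelian
    ([inverted_product_abelian]): modulo 'L_3(P) the commutator [u, v] is
    fixed by the automorphism, but every central element u^i v^j is inverted
    by it, so P' = 'L_3(P) and nilpotency gives P' = 1.  The case
    r1 = u r0 is dual.  If r1 = u r0 r2, both numbers in the type are even, so
    that G is not tight because 8 does not divide #|G|; and P is not abelian,
    since otherwise <r0, r1> and <r1, r2> would share an involution other than
    r1.

    For uniqueness, a group of the given type is tight, so P is abelian and
    every element of P has a unique square root.  The square roots x of u u^r0
    and y of u (u^r0)^-1 satisfy the relations of the presentation and
    u = x y.  For existence, the presented group is the direct product of the
    dihedral groups of orders 2 p^l2 and 2 p^l1; there <r1, r2> lies in the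
    graph of the reduction of the first factor onto the second, which l1 <= l2
    makes possible and which yields the intersection property. *)

(** * Involutions *)

Section Involutions.
Variable gT : finGroupType.
Implicit Types (P : {group gT}) (r s t x : gT).

Lemma involution_neq1 t : #[t] = 2 -> t != 1.
Proof. by move=> ot; rewrite -order_eq1 ot. Qed.

Lemma involution_sqr t : #[t] = 2 -> t * t = 1.
Proof. by move=> ot; rewrite -expg2 -ot expg_order. Qed.

Lemma involutionV t : #[t] = 2 -> t^-1 = t.
Proof. by move/involution_sqr=> tt; apply/eqP; rewrite eq_invg_mul tt. Qed.

Lemma involution_mul s t : #[s] = 2 -> #[t] = 2 -> s != t -> commute s t ->
  #[s * t] = 2.
Proof.
move=> os ot nst cst; apply: nt_prime_order => //.
  by rewrite expgMn // !expg2 (involution_sqr os) (involution_sqr ot) mulg1.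
by rewrite -eq_invg_mul (involutionV os).
Qed.

Lemma involution_notin_odd P t : odd #|P| -> #[t] = 2 -> t \notin P.
Proof.
by move=> oddP ot; apply/negP=> /order_dvdG; rewrite ot dvdn2 oddP.
Qed.

Lemma conj_mul_involutionr s t : #[s] = 2 -> #[t] = 2 -> (s * t) ^ t = (s * t)^-1.
Proof.
move=> os ot; rewrite conjgE !mulgA invMg (involutionV os) (involutionV ot).
by rewrite -mulgA (involution_sqr ot) mulg1.
Qed.

Lemma conj_mul_involutionl s t : #[s] = 2 -> #[t] = 2 -> (s * t) ^ s = (s * t)^-1.
Proof.
move=> os ot; rewrite conjgE !mulgA invMg (involutionV os) (involutionV ot).
by rewrite (involution_sqr os) mul1g.
Qed.

(** Squares of the products of adjacent generators of a string group: r2 can be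
    inserted on both sides of r0 because it commutes with it. *)
Lemma sqr_mul_involutions r0 r1 r2 : #[r0] = 2 -> #[r1] = 2 -> #[r2] = 2 ->
  commute r0 r2 -> (r0 * r1) ^+ 2 = (r1 * r2) ^ r0 * (r1 * r2)^-1.
Proof.
move=> or0 or1 or2 c02.
have r202 : r2 * r0 * r2 = r0.
  by rewrite -c02 -mulgA (involution_sqr or2) mulg1.
rewrite expg2 conjgE invMg (involutionV or0) (involutionV or1).
rewrite (involutionV or2) -!mulgA; congr (_ * (_ * _)).
by rewrite !mulgA r202.
Qed.

Lemma cycle_sqr_odd x : odd #[x] -> <[x ^+ 2]> = <[x]>.
Proof.
move=> ox; apply/esym/eqP.
by have := generator_coprime x 2; rewrite coprimen2 ox.
Qed.

Lemma odd_sqr_mem P x : odd #[x] -> x ^+ 2 \in P -> x \in P.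
Proof. by move=> ox; rewrite -!cycle_subG cycle_sqr_odd. Qed.

Lemma commuting_involutions_gen r s : #[r] = 2 -> #[s] = 2 -> commute r s ->
  <<[set r; s]>> = [set 1; r; s; r * s].
Proof.
move=> or os crs.
have -> : <<[set r; s]>> = <[r]> <*> <[s]> by rewrite joing_idl joing_idr.
rewrite cent_joinEr ?cycle_subG /=; last first.
  by rewrite cent_cycle; apply/cent1P/commute_sym.
rewrite (cycle2g or) (cycle2g os); apply/setP=> g; rewrite !inE -!orbA.
apply/mulsgP/or4P => [[a b /set2P[]-> /set2P[]-> ->]|].
- by rewrite mulg1 eqxx; constructor.
- by rewrite mul1g eqxx; constructor.
- by rewrite mulg1 eqxx; constructor.
- by rewrite eqxx; constructor.
by case=> /eqP->; [exists 1 1 | exists r 1 | exists 1 s | exists r s];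
  rewrite ?inE ?eqxx ?orbT ?mulg1 ?mul1g.
Qed.
End Involutions.

(** * Normality of a subgroup of odd order and index four *)

Section IndexFour.
Variable gT : finGroupType.
Implicit Types (G P : {group gT}) (s t x : gT).

(** If P x s = P x, then a conjugate of the involution s lies in P. *)
Lemma involution_move_rcoset P s x : odd #|P| -> #[s] = 2 ->
  P :* x :* s != P :* x.
Proof.
move=> oddP os; apply/eqP; rewrite -rcosetM => /rcoset_eqP.
rewrite mem_rcoset -[x in x * s]invgK -mulgA -conjgE.
by apply/negP/involution_notin_odd; rewrite ?orderJ.
Qed.

(** On four points, two fixed-point-free involutions s and t commute: if they
    differ at c, then c, cs, ct are distinct, and both cst and cts can only be
    the fourth point. *)
Lemma involutions_commute_rcosets G P s t x :
  odd #|P| -> P \subset G -> #|G : P| = 4 -> s \in G -> t \in G -> x \in G ->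
  #[s] = 2 -> #[t] = 2 -> P :* x :* s :* t = P :* x :* t :* s.
Proof.
move=> oddP sPG iPG Gs Gt Gx os ot; set c := P :* x.
have act2 r (d : {set gT}) : #[r] = 2 -> d :* r :* r = d.
  by move=> or; rewrite -rcosetM (involution_sqr or) rcoset1.
have inj r (d e : {set gT}) : #[r] = 2 -> d :* r = e :* r -> d = e.
  by move=> or de; rewrite -(act2 r d or) de act2.
have fpf r y : #[r] = 2 -> P :* y :* r = P :* y -> False.
  by move=> or /eqP; apply/negP/involution_move_rcoset.
have [cst | nst] := eqVneq (c :* s) (c :* t).
  by rewrite cst act2 // -cst act2.
have [//|ne] := eqVneq (c :* s :* t) (c :* t :* s).
(* Otherwise P would have five distinct cosets. *)
have uL: uniq [:: c; c :* s; c :* t; c :* s :* t; c :* t :* s].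
  rewrite /= !inE !negb_or nst ne !andbT /= -!andbA.
  do ![apply/andP; split]; apply/eqP => h.
  - exact: (fpf s x os (esym h)).
  - exact: (fpf t x ot (esym h)).
  - by case/eqP: nst; apply: (inj t _ _ ot); rewrite act2 -?h.
  - by case/eqP: nst; apply: (inj s _ _ os); rewrite act2 -?h.
  - by apply: (fpf t (x * s) ot); rewrite rcosetM -/c -h.
  - by apply: (fpf t x ot); apply: (inj s _ _ os); rewrite -/c -h.
  - by apply: (fpf s x os); apply: (inj t _ _ ot); rewrite -/c -h.
  - by apply: (fpf s (x * t) os); rewrite rcosetM -/c -h.
have sL: {subset [:: c; c :* s; c :* t; c :* s :* t; c :* t :* s]
            <= rcosets P G}.
  apply/allP; rewrite /c -!rcosetM /=.
  by rewrite !mem_rcosets ?mulSGid // Gx !groupM.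
have := uniq_leq_size uL (fun d dL => etrans (mem_enum _ d) (sL d dL)).
by rewrite -cardE [#|_|]iPG.
Qed.

(** The generators commute modulo the core of P, so the derived subgroup of G
    is contained in P. *)
Lemma odd_index4_normal G P (S : {set gT}) :
  odd #|P| -> P \subset G -> #|G : P| = 4 -> <<S>> = G ->
  {in S, forall s, #[s] = 2} -> P <| G.
Proof.
move=> oddP sPG iPG genG invS.
have sSG : S \subset G by rewrite -genG subset_gen.
apply: sub_der1_normal (sPG); apply: (subset_trans _ (gcore_sub P G)).
have nKG := gcore_norm P G; have nKS := subset_trans sSG nKG.
apply: der1_min => //=.
have -> : G / gcore P G = <<S>> / gcore P G by rewrite genG.
rewrite quotient_gen // abelian_gen.
rewrite /abelian quotient_cents2 // gen_subG.
apply/subsetP=> _ /imset2P[s t Ss St ->].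
apply/bigcapP=> x Gx; rewrite mem_conjg.
have Gs := subsetP sSG _ Ss; have Gt := subsetP sSG _ St.
have := involutions_commute_rcosets oddP sPG iPG Gs Gt Gx
          (invS s Ss) (invS t St).
rewrite -!rcosetM => /rcoset_eqP; rewrite mem_rcoset.
rewrite commgEl !conjgE !invMg !invgK !mulgA.
by rewrite (involutionV (invS s Ss)) (involutionV (invS t St)).
Qed.
End IndexFour.

(** * Products of two cyclic groups inverted by an automorphism *)

Section Inverted.
Variable gT : finGroupType.
Implicit Types (P : {group gT}) (t u v : gT).

(** The central commutator c = [u, v] is fixed by t, since [u^-1, v^-1] is
    conjugate to [u, v].  But c = u^i v^j as well, and t maps this element to
    u^-i v^-j, a conjugate of c^-1.  So c^2 = 1 in a group of odd order. *)
Lemma inverted_class2_commute P t u v :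
  odd #|P| -> <[u]> * <[v]> = P -> [~ u, v] \in 'C(P) ->
  u ^ t = u^-1 -> v ^ t = v^-1 -> commute u v.
Proof.
move=> oddP defP cPc ut vt.
have [] := mulG_sub defP; rewrite !cycle_subG => Pu Pv.
set c := [~ u, v] in cPc *.
have Pc : c \in P by rewrite groupR.
have cJ x : x \in P -> c ^ x = c.
  by move=> Px; rewrite conjgE (centP cPc) // mulKg.
have fixc : c ^ t = c.
  rewrite {1}/c conjRg ut vt -[RHS](cJ ((v * u)^-1)) ?groupV ?groupM //.
  by rewrite /c !commgEl !conjgE !invMg !invgK !mulgA mulgK mulgV mul1g.
have /mulsgP[_ _ /cycleP[i ->] /cycleP[j ->] ci] : c \in <[u]> * <[v]>.
  by rewrite defP.
have invc : c ^ t = c^-1.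
  rewrite -[c^-1](_ : c^-1 ^ (u ^+ i) = _); last by rewrite conjVg cJ ?groupX.
  by rewrite {1 2}ci conjMg !conjXg ut vt conjgE !invMg !expgVn mulgKV.
have c2 : c ^+ 2 = 1 by rewrite expg2 -{1}fixc invc mulVg.
apply/commgP; apply/negPn/negP=> ntc.
have oc : #[c] = 2 by apply: (@nt_prime_order _ 2).
by have := involution_notin_odd oddP oc; rewrite Pc.
Qed.

Lemma abelian_gen2 u v : commute u v -> abelian <<[set u; v]>>.
Proof.
move=> cuv; rewrite abelian_gen; apply/centsP.
by move=> a /set2P[]-> b /set2P[]->.
Qed.
End Inverted.

(** The class 2 case applied to P modulo the third term of its lower central
    series shows that P' is contained in that term; nilpotency then forces
    P' = 1. *)
Lemma inverted_product_abelian (gT : finGroupType) (P : {group gT}) (t u v : gT) :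
  odd #|P| -> nilpotent P -> <[u]> * <[v]> = P ->
  u ^ t = u^-1 -> v ^ t = v^-1 -> abelian P.
Proof.
move=> oddP nilP defP ut vt.
have [] := mulG_sub defP; rewrite !cycle_subG => Pu Pv.
have genP : <<[set u; v]>> = P.
  apply/eqP; rewrite eqEsubset gen_subG subUset !sub1set Pu Pv.
  by rewrite -defP mul_subG // cycle_subG mem_gen // !inE eqxx ?orbT.
have nPt : t \in 'N(P) by rewrite inE -defP conjsMg -!cycleJ ut vt !cycleV.
pose N := 'L_3(P)%G.
have nNP : P \subset 'N(N) by apply: char_norm; apply: lcn_char.
have nNt : t \in 'N(N).
  by rewrite -sub1set (char_norm_trans (lcn_char 3 P)) // sub1set.
have cuv : commute (coset N u) (coset N v).
  apply: (@inverted_class2_commute _ (P / N)%G (coset N t)).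
  - exact: dvdn_odd (dvdn_quotient P N) oddP.
  - rewrite -!quotient_cycle ?(subsetP nNP) // -quotientMl ?defP //.
    by rewrite cycle_subG (subsetP nNP).
  - rewrite -morphR ?(subsetP nNP) //=.
    have [_ sC] := subsetIP (lcn_central 2 P).
    have cPuv: [~ u, v] \in 'L_2(P) by rewrite lcn2 mem_commg.
    exact: (subsetP sC _ (mem_quotient N cPuv)).
  - by rewrite -morphJ ?(subsetP nNP _ Pu) // ut morphV ?(subsetP nNP _ Pu).
  - by rewrite -morphJ ?(subsetP nNP _ Pv) // vt morphV ?(subsetP nNP _ Pv).
have sP1N : P^`(1) \subset N.
  apply: der1_min => //; rewrite -genP quotient_gen; last first.
    by rewrite (subset_trans _ nNP) // subUset !sub1set Pu.
  rewrite quotientU !quotient_set1 ?(subsetP nNP) //.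
  exact: abelian_gen2.
have [P1 | ntP1] := eqVneq (P^`(1) : {set gT}) 1; first exact/derG1P.
have nP1 : P \subset 'N_P(P^`(1)) by rewrite subsetI subxx der_norm.
have := nil_comm_properl nilP (der_sub 1 P) ntP1 nP1.
have defN : N = [~: P^`(1), P] :> {set gT} by rewrite /N /= lcnSn lcn2.
by rewrite -defN /proper sP1N andbF.
Qed.

(** * The intersection property in rank three *)

Section StringC.
Variable gT : finGroupType.
Implicit Types (G : {group gT}) (r s : gT).

(** The Klein group <r0, r2> meets <r0, r1> in <r0> only: otherwise r2 would
    lie in <r0, r1>, hence in <r0, r1> :&: <r1, r2> = <r1>. *)
Lemma dihedral_meet_klein r0 r1 r2 :
  #[r0] = 2 -> #[r1] = 2 -> #[r2] = 2 -> r2 != r1 -> commute r0 r2 ->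
  <<[set r0; r1]>> :&: <<[set r1; r2]>> \subset <[r1]> ->
  <<[set r0; r1]>> :&: <<[set r0; r2]>> \subset <[r0]>.
Proof.
move=> or0 or1 or2 n21 c02 sI.
have nr2 : r2 \notin <<[set r0; r1]>>.
  apply/negP=> h; have : r2 \in <[r1]>.
    by apply: (subsetP sI); rewrite inE h mem_gen // !inE eqxx orbT.
  by rewrite (cycle2g or1) !inE (negPf n21) orbF (negPf (involution_neq1 or2)).
apply/subsetP=> g /setIP[Ag].
rewrite (commuting_involutions_gen or0 or2 c02) (cycle2g or0) !inE -!orbA.
case/or4P=> /eqP gE; rewrite gE ?eqxx ?orbT // in Ag *.
  by case/negP: nr2.
have r0A : r0 \in <<[set r0; r1]>> by rewrite mem_gen // !inE eqxx.
by rewrite groupMl // in Ag; case/negP: nr2.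
Qed.

Let o0 : 'I_3 := @Ordinal 3 0 isT.
Let o1 : 'I_3 := @Ordinal 3 1 isT.
Let o2 : 'I_3 := @Ordinal 3 2 isT.

Lemma gen_sub_mask r0 r1 r2 (I : {set 'I_3}) :
  gen_sub r0 r1 r2 I =
  <<(if o0 \in I then [set r0] else set0) :|:
    (if o1 \in I then [set r1] else set0) :|:
    (if o2 \in I then [set r2] else set0)>> :> {set gT}.
Proof.
congr <<_>>; apply/setP=> g; rewrite !inE; apply/imsetP/idP=> [[i]|].
  case: i => [[|[|[|//]]] lti] Ii ->; rewrite (tnth_nth 1) /=.
  - by rewrite (_ : o0 = Ordinal lti) ?Ii ?inE ?eqxx //; apply: val_inj.
  - by rewrite (_ : o1 = Ordinal lti) ?Ii ?inE ?eqxx ?orbT //; apply: val_inj.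
  - by rewrite (_ : o2 = Ordinal lti) ?Ii ?inE ?eqxx ?orbT //; apply: val_inj.
case/orP=> [/orP[]|]; case: ifP => Ii; rewrite inE // => /eqP->.
- by exists o0; rewrite // (tnth_nth 1).
- by exists o1; rewrite // (tnth_nth 1).
- by exists o2; rewrite // (tnth_nth 1).
Qed.

(** Every instance of the intersection property follows from the one for
    I = {0, 1} and J = {1, 2}.  It suffices that each <r_i | i in I> is the
    intersection of the maximal ones, those that omit a single k not in I; then
    both sides of the property are the intersection of the same family.  This
    form is symmetric in r0 and r2, which gives duality. *)
Lemma string_C_groupE G r0 r1 r2 :
  string_C_group G r0 r1 r2 <->
  [/\ uniq [:: r0; r1; r2], involutions r0 r1 r2, <<[set r0; r1; r2]>> = G,
      string_property r0 r2 &
      <<[set r0; r1]>> :&: <<[set r1; r2]>> \subset <[r1]>].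
Proof.
split=> -[ur ir gr sr hI]; split=> //.
  have := hI [set o0; o1] [set o1; o2].
  by rewrite !gen_sub_mask !inE /= !set0U !setU0 => ->.
case: (ir) => or0 or1 or2; move: ur; rewrite /= !inE negb_or andbT.
case/andP=> /andP[n01 n02] n12.
have s0 : <<[set r0; r1]>> :&: <<[set r0; r2]>> \subset <[r0]>.
  by apply: dihedral_meet_klein; rewrite // eq_sym.
have s2 : <<[set r1; r2]>> :&: <<[set r0; r2]>> \subset <[r2]>.
  rewrite (setUC [set r1]) (setUC [set r0]).
  apply: (@dihedral_meet_klein r2 r1 r0) => //.
  by rewrite (setUC [set r2]) (setUC _ [set r0]) setIC.
have M0 : gen_sub r0 r1 r2 (~: [set o0]) = <<[set r1; r2]>> :> {set gT}.
  by rewrite gen_sub_mask !inE /= set0U.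
have M1 : gen_sub r0 r1 r2 (~: [set o1]) = <<[set r0; r2]>> :> {set gT}.
  by rewrite gen_sub_mask !inE /= setU0.
have M2 : gen_sub r0 r1 r2 (~: [set o2]) = <<[set r0; r1]>> :> {set gT}.
  by rewrite gen_sub_mask !inE /= setU0.
have facets g (I : {set 'I_3}) : g \in gen_sub r0 r1 r2 setT ->
    (forall k, k \notin I -> g \in gen_sub r0 r1 r2 (~: [set k])) ->
  g \in gen_sub r0 r1 r2 I.
  move=> gI /[dup] /[dup] /(_ o0) g0 /(_ o1) g1 /(_ o2) g2.
  move: gI g0 g1 g2; rewrite M0 M1 M2 !gen_sub_mask !inE.
  case: (o0 \in I); case: (o1 \in I); case: (o2 \in I) => /= gI g0 g1 g2;
    rewrite ?(set0U, setU0) // ?g0 ?g1 ?g2 //.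
  - by apply: (subsetP s0); rewrite inE g1 ?g2.
  - by apply: (subsetP hI); rewrite inE g0 ?g2.
  - by apply: (subsetP s2); rewrite inE g0 ?g1.
  have : g \in <[r0]> by apply: (subsetP s0); rewrite inE g1 ?g2.
  have : g \in <[r1]> by apply: (subsetP hI); rewrite inE g0 ?g2.
  rewrite (cycle2g or0) (cycle2g or1) !inE.
  case/orP=> /eqP->; first by rewrite group1.
  by rewrite [_ == r0]eq_sym (negPf n01) orbF (negPf (involution_neq1 or1)).
have mono (I J : {set 'I_3}) : I \subset J ->
    gen_sub r0 r1 r2 I \subset gen_sub r0 r1 r2 J.
  by move=> sIJ; apply: genS; apply: imsetS.
move=> I J; apply/eqP; rewrite eqEsubset subsetI.
rewrite !(mono (I :&: J)) ?subsetIl ?subsetIr // !andbT.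
apply/subsetP=> g /setIP[gI gJ]; apply: facets.
  exact: (subsetP (mono _ _ (subsetT I)) g gI).
by move=> k; rewrite inE negb_and => /orP[] nk;
  [apply: subsetP gI | apply: subsetP gJ]; apply: mono;
  rewrite subsetC sub1set inE.
Qed.

Lemma string_C_group_dual G r0 r1 r2 :
  string_C_group G r0 r1 r2 -> string_C_group G r2 r1 r0.
Proof.
case/string_C_groupE=> u [or0 or1 or2] gr sr sI.
apply/string_C_groupE; split=> //.
- move: u; rewrite /= !inE !negb_or !andbT [r2 == r1]eq_sym [r2 == r0]eq_sym.
  by rewrite [r1 == r0]eq_sym => /andP[/andP[-> ->] ->].
- by rewrite -gr -setUA setUC (setUC [set r1]).
- by rewrite (setUC [set r2]) (setUC [set r1] [set r0]) setIC.
Qed.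
End StringC.

(** * String C-groups with a subgroup of odd order and index four *)

Section OddIndexFour.
Variables (gT : finGroupType) (G P : {group gT}) (r0 r1 r2 : gT).
Hypothesis scg : string_C_group G r0 r1 r2.
Hypothesis oddP : odd #|P|.
Hypothesis sPG : P \subset G.
Hypothesis cardG : #|G| = (4 * #|P|)%N.

Let or0 : #[r0] = 2. Proof. by case: scg => _ []. Qed.
Let or1 : #[r1] = 2. Proof. by case: scg => _ []. Qed.
Let or2 : #[r2] = 2. Proof. by case: scg => _ []. Qed.
Let c02 : commute r0 r2. Proof. by case: scg. Qed.
Let genG : <<[set r0; r1; r2]>> = G. Proof. by case: scg. Qed.
Let or02 : #[r0 * r2] = 2.
Proof.
apply: involution_mul => //; case: scg => + _ _ _ _.
by rewrite /= !inE !negb_or => /andP[/andP[]].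
Qed.
Let TI : <<[set r0; r1]>> :&: <<[set r1; r2]>> \subset <[r1]>.
Proof. by case/string_C_groupE: scg. Qed.
Let Gr0 : r0 \in G. Proof. by rewrite -genG mem_gen // !inE eqxx. Qed.
Let Gr1 : r1 \in G. Proof. by rewrite -genG mem_gen // !inE eqxx ?orbT. Qed.
Let Gr2 : r2 \in G. Proof. by rewrite -genG mem_gen // !inE eqxx ?orbT. Qed.

Lemma odd_index4_normal_string : P <| G.
Proof.
apply: (odd_index4_normal (S := [set r0; r1; r2])) => //.
  by rewrite -divgS // cardG mulnK.
by move=> s; rewrite !inE => /orP[/orP[]|] /eqP->.
Qed.
Let nPG : G \subset 'N(P).
Proof. exact: normal_norm odd_index4_normal_string. Qed.
Let Pconj g x : g \in G -> (x ^ g \in P) = (x \in P).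
Proof. by move=> Gg; rewrite memJ_norm ?(subsetP nPG). Qed.

Let nr0 : r0 \notin P. Proof. exact: involution_notin_odd. Qed.
Let nr1 : r1 \notin P. Proof. exact: involution_notin_odd. Qed.
Let nr2 : r2 \notin P. Proof. exact: involution_notin_odd. Qed.
Let nr02 : r0 * r2 \notin P. Proof. exact: involution_notin_odd. Qed.

Let D := <<[set r0; r2]>>%G.
Let defD : D = [set 1; r0; r2; r0 * r2] :> {set gT}.
Proof. exact: commuting_involutions_gen. Qed.
Let cardD : #|D| = 4.
Proof.
have n02 : r0 != r2.
  by case: scg => + _ _ _ _; rewrite /= !inE !negb_or => /andP[/andP[]].
have n2 : r2 != r0 * r2.
  by rewrite -[X in X != _]mul1g (inj_eq (mulIg r2)) eq_sym involution_neq1.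
have n0 : r0 != r0 * r2.
  by rewrite -[X in X != _]mulg1 (inj_eq (mulgI r0)) eq_sym involution_neq1.
rewrite defD -!setUA !cardsU1 cards1 !inE !negb_or n02 n0 n2.
by rewrite ![1%g == _]eq_sym ?involution_neq1.
Qed.

Lemma odd_index4_complement : P * D = G.
Proof.
have tiPD : P :&: D = 1.
  by apply: coprime_TIg; rewrite cardD (coprimeXr 2 (n := 2)) // coprimen2.
apply/eqP; rewrite eqEcard mul_subG //=; last first.
  by rewrite gen_subG subUset !sub1set Gr0.
by rewrite TI_cardMg // cardD cardG mulnC.
Qed.

Lemma generator_mod_cases :
  [\/ r1 * r2 \in P, r0 * r1 \in P | r1 * (r0 * r2) \in P].
Proof.
have := Gr1; rewrite -odd_index4_complement => /mulsgP[w d Pw Dd def_r1].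
move: Dd; rewrite defD !inE -!orbA.
case/or4P=> /eqP dE; rewrite dE in def_r1.
- by case/negP: nr1; rewrite def_r1 mulg1.
- constructor 2; rewrite -(Pconj _ Gr0) conjgE -mulgA mulKg def_r1 -mulgA.
  by rewrite (involution_sqr or0) mulg1.
- by constructor 1; rewrite def_r1 -mulgA (involution_sqr or2) mulg1.
- by constructor 3; rewrite def_r1 -mulgA (involution_sqr or02) mulg1.
Qed.

(** Q <r0, r2> is a subgroup that contains the three generators, so it is G and
    Q has index at most 4. *)
Lemma index4_closed_sub_eq (Q : {group gT}) :
  Q \subset P -> r0 \in 'N(Q) -> r2 \in 'N(Q) -> r1 \in Q * D -> Q :=: P.
Proof.
move=> sQP N0 N2 QDr1.
have nQD : D \subset 'N(Q) by rewrite gen_subG subUset !sub1set N0.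
have sG : G \subset Q * D.
  rewrite -(norm_joinEr nQD) -genG gen_subG !subUset !sub1set /=.
  rewrite norm_joinEr // QDr1 andbT.
  by rewrite !(subsetP (mulG_subr Q D)) // mem_gen // !inE eqxx ?orbT.
apply/eqP; rewrite eqEcard sQP -(leq_pmul2r (isT : 0 < 4)).
rewrite mulnC -cardG (leq_trans (subset_leq_card sG)) //.
by rewrite -cardD mul_cardG leq_pmulr ?cardG_gt0.
Qed.

Section CongruentR2.
Hypothesis Pu : r1 * r2 \in P.
Let u := r1 * r2.
Let v := (r0 * r1) ^+ 2.

Let def_v : v = u ^ r0 * u^-1.
Proof. exact: sqr_mul_involutions. Qed.
Let Pv : v \in P. Proof. by rewrite def_v groupM ?groupV ?Pconj. Qed.
Let ur1 : u ^ r1 = u^-1. Proof. exact: conj_mul_involutionl. Qed.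
Let vr0 : v ^ r0 = v^-1.
Proof. by rewrite conjXg conj_mul_involutionl // expgVn. Qed.
Let vr1 : v ^ r1 = v^-1.
Proof. by rewrite conjXg conj_mul_involutionr // expgVn. Qed.

(** The order of r0 r1 is even, because r0 r1 is congruent to the involution
    r0 r2 modulo P. *)
Lemma order_mul_r01 : #[r0 * r1] = (2 * #[v])%N.
Proof.
have even : 2 %| #[r0 * r1].
  rewrite dvdn2; apply/negP=> oddr.
  have P01 := odd_sqr_mem oddr Pv; case/negP: nr02.
  have -> : r0 * r2 = r0 * r1 * u.
    by rewrite /u -mulgA (mulgA r1) (involution_sqr or1) mul1g.
  exact: groupM.
by rewrite /v orderXdiv // mulnC divnK.
Qed.

(** The intersection lies in <r0, r1> :&: <r1, r2> = {1, r1} and in P, which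
    does not contain r1. *)
Lemma rotation_cycles_TI : <[u]> :&: <[v]> = 1.
Proof.
apply/trivgP/subsetP=> g /setIP[ug vg].
have: g \in <[r1]>.
  apply: (subsetP TI); rewrite inE.
  rewrite (subsetP _ g vg) ?(subsetP _ g ug) // cycle_subG /u /v ?groupX //;
    by rewrite groupM ?mem_gen // !inE eqxx ?orbT.
rewrite (cycle2g or1) !inE => /orP[//|/eqP g1].
case/negP: nr1; rewrite -g1; move: g ug {vg g1}.
by apply/subsetP; rewrite cycle_subG.
Qed.

Lemma tight_rotations : tight G r0 r1 r2 <-> <[u]> * <[v]> = P.
Proof.
have cuv : #|<[u]> * <[v]>| = (#[u] * #[v])%N.
  exact: TI_cardMg rotation_cycles_TI.
have suv : <[u]> * <[v]> \subset P by rewrite mul_subG ?cycle_subG.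
rewrite /tight /= cardG order_mul_r01 -/u mulnA -[4]/(2 * 2)%N -!mulnA.
split=> [tE|def_P].
  have {}tE : #|P| = (#[v] * #[u])%N.
    by move: tE; move: #|P| #[v] #[u]; clear; lia.
  by apply/eqP; rewrite eqEcard suv cuv tE mulnC /=.
by rewrite -def_P cuv [(#[u] * _)%N]mulnC.
Qed.

(** The product <u><v> is then a subgroup; it is normalized by r1, which inverts
    u and v, by u, and by r0, which inverts v and maps u to v u. *)
Lemma abelian_rotations : abelian P -> <[u]> * <[v]> = P.
Proof.
move=> abP; have cP x y : x \in P -> y \in P -> x * y = y * x.
  by move=> Px Py; apply: (centsP abP).
have defQ : <[u]> <*> <[v]> = <[u]> * <[v]>.
  by apply: cent_joinEr; rewrite cycle_subG /= cent_cycle; apply/cent1P/cP.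
rewrite -defQ; pose Q := (<[u]> <*> <[v]>)%G.
have Qu : u \in Q by rewrite mem_gen // inE cycle_id.
have Qv : v \in Q by rewrite mem_gen // inE cycle_id orbT.
have nQ r : u ^ r \in Q -> v ^ r \in Q -> r \in 'N(Q).
  move=> ur vr; rewrite inE /= -genJ conjUg -!cycleJ gen_subG subUset.
  by rewrite !cycle_subG ur vr.
apply: (@index4_closed_sub_eq Q).
- by rewrite join_subG !cycle_subG Pu.
- by apply: nQ; rewrite ?vr0 ?groupV // -[u ^ r0](mulgKV u) -def_v groupM.
- have -> : r2 = r1 * u by rewrite /u mulgA (involution_sqr or1) mul1g.
  rewrite groupM ?(subsetP (normG Q) u Qu) //.
  by apply: nQ; rewrite ?ur1 ?vr1 groupV.
- have -> : r1 = u * r2 by rewrite /u -mulgA (involution_sqr or2) mulg1.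
  by rewrite mem_mulg // mem_gen // !inE eqxx orbT.
Qed.

Lemma congr_r2_abelian_tight : nilpotent P -> abelian P <-> tight G r0 r1 r2.
Proof.
move=> nilP; rewrite tight_rotations; split; first exact: abelian_rotations.
by move=> defP; apply: inverted_product_abelian oddP nilP defP ur1 vr1.
Qed.
End CongruentR2.

Section CongruentR02.
Hypothesis Pu : r1 * (r0 * r2) \in P.
Let u := r1 * (r0 * r2).

Let def_r1 : r1 = u * (r0 * r2).
Proof. by rewrite /u -mulgA (involution_sqr or02) mulg1. Qed.
Let u02 : u ^ (r0 * r2) = u^-1. Proof. exact: conj_mul_involutionr. Qed.
Let def_r12 : r1 * r2 = u * r0.
Proof. by rewrite {1}def_r1 -!mulgA (involution_sqr or2) mulg1. Qed.
Let def_r01 : r0 * r1 = u ^ r0 * r2.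
Proof. by rewrite conjgE (involutionV or0) {1}def_r1 !mulgA. Qed.
Let def_a : (r1 * r2) ^+ 2 = u * u ^ r0.
Proof. by rewrite expg2 def_r12 conjgE (involutionV or0) !mulgA. Qed.
Let def_b : (r0 * r1) ^+ 2 = u ^ r0 * u^-1.
Proof.
rewrite -u02 expg2 def_r01 conjgM (conjgE _ r2).
by rewrite (involutionV or2) !mulgA.
Qed.
Let Pa : (r1 * r2) ^+ 2 \in P.
Proof. by rewrite def_a groupM ?Pconj. Qed.
Let Pb : (r0 * r1) ^+ 2 \in P.
Proof. by rewrite def_b groupM ?groupV ?Pconj. Qed.

(** Both orders in the type are even, since r0 r1 and r1 r2 are not in P; a tight
    group would then have an order divisible by 8. *)
Lemma congr_r02_not_tight : ~ tight G r0 r1 r2.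
Proof.
have ev x : x ^+ 2 \in P -> x \notin P -> 2 %| #[x].
  move=> Px2 nPx; rewrite dvdn2; apply: contra nPx => oddx.
  exact: odd_sqr_mem oddx Px2.
have /dvdnP[k1 k1E] : 2 %| #[r0 * r1].
  by apply: ev; rewrite // def_r01 groupMl ?Pconj.
have /dvdnP[k2 k2E] : 2 %| #[r1 * r2].
  by apply: ev; rewrite // def_r12 groupMl.
rewrite /tight /= cardG k1E k2E => E.
have {}E : #|P| = (2 * (k1 * k2))%N.
  by move: E; move: #|P|; clear; nia.
by move: oddP; rewrite E oddM.
Qed.

(** Let a = (r1 r2)^2 = u u^r0 and b = (r0 r1)^2 = u^r0 u^-1.  A power of r1 r2
    with odd exponent #[a] is an involution a^k u r0 of <r1, r2>.  Its part
    g = a^k u has the square b^-1, so g is a power of b and a^k u r0 lies in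
    <r0, r1> too.  By the intersection property it is 1 or r1, but it is
    congruent to r0 modulo P. *)
Lemma congr_r02_not_abelian : ~ abelian P.
Proof.
move=> abP; have cP x y : x \in P -> y \in P -> commute x y.
  by move=> Px Py; apply: (centsP abP).
have := Pa; have := Pb.
pose a := (r1 * r2) ^+ 2; pose b := (r0 * r1) ^+ 2; rewrite -/a -/b => bP aP.
have odda : odd #[a] by apply: dvdn_odd oddP; apply: order_dvdG.
pose k := (#[a]./2)%N.
have ka : k.*2.+1 = #[a] by rewrite -[RHS]odd_double_half odda.
pose j := (r1 * r2) ^+ k.*2.+1.
pose g := a ^+ k * u.
have Pg : g \in P by rewrite /g groupM // groupX.
have jE : j = g * r0.
  by rewrite /j expgSr -mul2n expgM -/a def_r12 /g mulgA.
have g2 : g ^+ 2 = b^-1.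
  rewrite expgMn; last by apply: cP => //; apply: groupX.
  rewrite -expgM muln2.
  have -> : a ^+ k.*2 = a^-1.
    by apply/eqP; rewrite eq_sym eq_invg_mul -expgS ka expg_order.
  rewrite /a /b def_a def_b (invMg u) (invMg _ u^-1) invgK expg2 mulgA mulgKV.
  by apply: cP; rewrite // groupV Pconj.
have bg : g \in <[b]>.
  have oddg : odd #[g] by apply: dvdn_odd oddP; apply: order_dvdG.
  by rewrite -cycleV -g2 cycle_sqr_odd ?cycle_id.
have r0A : r0 \in <<[set r0; r1]>> by rewrite mem_gen // !inE eqxx.
have r1A : r1 \in <<[set r0; r1]>> by rewrite mem_gen // !inE eqxx orbT.
have r1B : r1 \in <<[set r1; r2]>> by rewrite mem_gen // !inE eqxx.
have r2B : r2 \in <<[set r1; r2]>> by rewrite mem_gen // !inE eqxx orbT.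
have: j \in <[r1]>.
  apply: (subsetP TI); apply/setIP; split; last by rewrite groupX ?groupM.
  rewrite jE groupM //; apply: (subsetP _ _ bg).
  by rewrite cycle_subG groupX ?groupM.
rewrite (cycle2g or1) !inE jE => /orP[] /eqP gE.
  by case/negP: nr0; rewrite -(groupMl _ Pg) gE.
have r2E : r2 = (u^-1 * g) ^ r0.
  rewrite conjgE (involutionV or0) -(mulgA u^-1) gE [X in u^-1 * X]def_r1 mulKg.
  by rewrite mulgA (involution_sqr or0) mul1g.
by case/negP: nr2; rewrite r2E Pconj // groupM ?groupV.
Qed.
End CongruentR02.
End OddIndexFour.

Theorem odd_index4_abelian_tight (gT : finGroupType) (G P : {group gT})
    (r0 r1 r2 : gT) :
  string_C_group G r0 r1 r2 -> odd #|P| -> nilpotent P -> P \subset G ->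
  #|G| = (4 * #|P|)%N -> abelian P <-> tight G r0 r1 r2.
Proof.
move=> scg oddP nilP sPG cardG.
have [Pu | Pu | Pu] := generator_mod_cases scg oddP sPG cardG.
- exact: congr_r2_abelian_tight.
- have scg' := string_C_group_dual scg.
  have orderC (s t : gT) : #[s] = 2 -> #[t] = 2 -> #[s * t] = #[t * s].
    by move=> os ot; rewrite -orderV invMg !involutionV.
  have [_ [o0 o1 o2] _ _ _] := scg.
  have Pu' : r1 * r0 \in P.
    by rewrite -groupV invMg !involutionV.
  rewrite (congr_r2_abelian_tight scg' oddP sPG cardG Pu' nilP) /tight /=.
  by rewrite (orderC r2 r1) // (orderC r1 r0) // mulnAC.
- by split=> [/(congr_r02_not_abelian scg oddP sPG cardG Pu)
             |/(congr_r02_not_tight scg oddP sPG cardG Pu)].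
Qed.

(** * Uniqueness *)

(** With w = u^r0, the generators are x = (u w)^h and y = (u w^-1)^h, where
    z^h is the square root of z in P: r0 exchanges u and w, r2 inverts both,
    and (u w)(u w^-1) = u^2 gives x y = u. *)
Lemma abelian_rotation_relations (gT : finGroupType) (G P : {group gT})
    (r0 r1 r2 : gT) :
  string_C_group G r0 r1 r2 -> odd #|P| -> P \subset G ->
  #|G| = (4 * #|P|)%N -> abelian P -> r1 * r2 \in P ->
  exists x y : gT,
    relations #[r1 * r2] #[(r0 * r1) ^+ 2] x y r0 r2 /\ r1 = x * y * r2.
Proof.
move=> scg oddP sPG cardG abP Pu.
have [_ [or0 or1 or2] genG c02 _] := scg.
have nPG : G \subset 'N(P).
  exact: normal_norm (odd_index4_normal_string scg oddP sPG cardG).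
have Gr0 : r0 \in G by rewrite -genG mem_gen // !inE eqxx.
move def_u: (r1 * r2) Pu => u Pu; move def_w: (u ^ r0) => w.
have Pw : w \in P by rewrite -def_w memJ_norm ?(subsetP nPG).
have cP (a b : gT) : a \in P -> b \in P -> commute a b.
  by move=> Pa Pb; apply: (centsP abP).
have cuw : commute u w by apply: cP.
have cuw' : commute u w^-1 by apply: cP; rewrite ?groupV.
pose h := expg_invn P 2.
have sqrtK (z : gT) : z \in P -> (z ^+ 2) ^+ h = z.
  by apply: expgK; rewrite coprimen2.
have ur2 : u ^ r2 = u^-1 by rewrite -def_u conj_mul_involutionr.
have wr2 : w ^ r2 = w^-1 by rewrite -def_w -conjgM c02 conjgM ur2 conjVg.
have wr0 : w ^ r0 = u by rewrite -def_w -conjgM (involution_sqr or0) conjg1.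
have vE : (r0 * r1) ^+ 2 = w * u^-1.
  by rewrite -def_w -def_u; apply: sqr_mul_involutions.
have kill n (z : gT) : z ^+ n = 1 -> (z ^+ h) ^+ n = 1.
  by move=> zn; rewrite expgAC zn expg1n.
exists ((u * w) ^+ h), ((u * w^-1) ^+ h); split; last first.
  rewrite -expgMn; last by apply: cP; rewrite groupM ?groupV.
  have -> : u * w * (u * w^-1) = u ^+ 2.
    by rewrite -mulgA (mulgA w) -cuw !mulgA mulgK.
  by rewrite sqrtK // -def_u -mulgA (involution_sqr or2) mulg1.
split; [split | split; [split | split]].
- by apply: kill; rewrite expgMn // -def_w -conjXg expg_order conj1g mulg1.
- apply: kill; rewrite vE; apply/eqP.
  by rewrite -eq_invg1 -expgVn invMg invgK expg_order.
- by rewrite expg2 involution_sqr.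
- by rewrite expg2 involution_sqr.
- by apply/eqP/commgP; apply: cP; rewrite groupX ?groupM ?groupV.
- by apply/eqP/commgP.
- by rewrite conjXg conjMg wr0 def_w -cuw.
- by rewrite conjXg conjMg ur2 wr2 -expgVn cuw invMg.
- by rewrite conjXg conjMg conjVg wr0 def_w -expgVn invMg invgK.
- by rewrite conjXg conjMg conjVg ur2 wr2 -expgVn cuw' invMg.
Qed.

(** The universal property gives a morphism from G onto H, and the orders agree.
    The isomorphism asked for is its inverse. *)
Lemma presented_scg_iso (a b : nat) (gT rT : finGroupType) (G : {group gT})
    (H : {group rT}) (x y r0 r1 r2 : gT) (x' y' s0 s1 s2 : rT) :
  presented a b G x y r0 r2 -> r1 = x * y * r2 -> r1 \in G -> #|G| = #|H| ->
  relations a b x' y' s0 s2 -> s1 = x' * y' * s2 ->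
  <<[set s0; s1; s2]>> = H ->
  scg_iso H s0 s1 s2 G r0 r1 r2.
Proof.
move=> [genG _ univ] def_r1 Gr1 oGH relH def_s1 genH.
have [f [fM [fx fy f0 f2]]] := univ rT x' y' s0 s2 relH.
pose fm := Morphism fM.
have mem z : z \in [set x; y; r0; r2] -> z \in G.
  by move=> zX; rewrite -genG mem_gen.
have Gx : x \in G by apply: mem; rewrite !inE eqxx.
have Gy : y \in G by apply: mem; rewrite !inE eqxx ?orbT.
have G0 : r0 \in G by apply: mem; rewrite !inE eqxx ?orbT.
have G2 : r2 \in G by apply: mem; rewrite !inE eqxx ?orbT.
have f1 : f r1 = s1.
  by rewrite def_r1 !fM ?groupM // fx fy f2.
have sHf : H \subset fm @* G.
  rewrite -genH gen_subG !subUset !sub1set -f0 -f1 -f2.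
  by rewrite !(mem_morphim fm).
have oHf : fm @* G = H.
  by apply/esym/eqP; rewrite eqEcard sHf -oGH leq_morphim.
have injf : 'injm fm by rewrite -card_im_injm oHf oGH.
have isof : isom G H fm by apply/isomP.
exists (isom_inv isof); split; first exact: isom_sym.
by split; rewrite -?f0 -?f1 -?f2; apply: (invmE (isom_inj isof)).
Qed.

Lemma Sylow_index4 (p m : nat) (gT : finGroupType) (G P : {group gT}) :
  prime p -> odd p -> #|G| = (4 * p ^ m)%N -> p.-Sylow(G) P ->
  [/\ odd #|P|, nilpotent P, P \subset G & #|G| = (4 * #|P|)%N].
Proof.
move=> pr_p odd_p oG sylP; have [sPG pP _] := and3P sylP.
have p4 : p^'.-nat 4.
  rewrite p'natE // (Euclid_dvdX 2 2 pr_p) dvdn_prime2 //.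
  by case: eqP odd_p => // ->.
have pm : p.-nat (p ^ m)%N by rewrite pnatX pnat_id.
have oP : #|P| = (p ^ m)%N.
  rewrite (card_Hall sylP) oG partnM // ?expn_gt0 ?prime_gt0 //.
  by rewrite (part_p'nat p4) (part_pnat_id pm) mul1n.
split; rewrite ?oP //; last exact: pgroup_nil pP.
by rewrite oddX odd_p orbT.
Qed.

(** The order of s1 s2 is odd, which places s1 s2 in the normal Sylow p-subgroup
    and decides the class of s1 modulo it. *)
Lemma tight_type_relations (p m l1 l2 : nat) (rT : finGroupType)
    (H : {group rT}) (s0 s1 s2 : rT) :
  prime p -> odd p -> (l1 + l2)%N = m ->
  string_C_group H s0 s1 s2 -> #|H| = (4 * p ^ m)%N ->
  schlafli_type s0 s1 s2 = ((2 * p ^ l1)%N, (p ^ l2)%N) ->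
  exists x y, relations (p ^ l2) (p ^ l1) x y s0 s2 /\ s1 = x * y * s2.
Proof.
move=> pr_p odd_p lm scg oH [k1 k2].
have [P sylP] := Sylow_exists p H.
have [oddP nilP sPH oHP] := Sylow_index4 pr_p odd_p oH sylP.
have tightH : tight H s0 s1 s2.
  by rewrite /tight /= k1 k2 oH -lm expnD !mulnA.
have abP : abelian P by apply/(odd_index4_abelian_tight scg).
have genH : <<[set s0; s1; s2]>> = H by case: scg.
have P12 : s1 * s2 \in P.
  rewrite (mem_normal_Hall sylP (odd_index4_normal_string scg oddP sPH oHP)).
    by rewrite /p_elt k2 pnatX pnat_id.
  by rewrite -genH groupM // mem_gen // !inE eqxx ?orbT.
have [x [y [rel def1]]] := abelian_rotation_relations scg oddP sPH oHP abP P12.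
exists x, y; split=> //; move: rel.
by rewrite k2 orderXdiv k1 ?dvdn_mulr // mulKn.
Qed.

(** * Dihedral groups *)

(** The pair (i, e) is the element a^i t^e of the group generated by a rotation a
    of order n and a reflection t; carrying the exponents makes the universal
    property in arbitrary groups a direct formula. *)
Definition dihedral (n : nat) : Type := ('Z_n * bool)%type.

Section DihedralGroup.
Variable n : nat.
Implicit Types g h : dihedral n.

HB.instance Definition _ := Finite.copy (dihedral n) ('Z_n * bool)%type.

Definition dihedral_mul g h : dihedral n :=
  ((if g.2 then g.1 - h.1 else g.1 + h.1)%R, g.2 (+) h.2).
Definition dihedral_one : dihedral n := (0%R, false).
Definition dihedral_inv g : dihedral n := ((if g.2 then g.1 else - g.1)%R, g.2).

Lemma dihedral_mulA : associative dihedral_mul.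
Proof.
move=> [i [|]] [j [|]] [l [|]]; congr (_, _) => /=;
  by rewrite ?opprD ?opprK ?addrA.
Qed.

Lemma dihedral_mul1 : left_id dihedral_one dihedral_mul.
Proof. by move=> [i e]; congr (_, _); rewrite /= add0r. Qed.

Lemma dihedral_mulV : left_inverse dihedral_one dihedral_inv dihedral_mul.
Proof.
by move=> [i [|]]; congr (_, _); rewrite /= ?subrr ?addNr.
Qed.

HB.instance Definition _ := Finite_isGroup.Build (dihedral n)
  dihedral_mulA dihedral_mul1 dihedral_mulV.
End DihedralGroup.

Section DihedralTheory.
Variable n : nat.
Hypothesis n_gt1 : 1 < n.

Definition rotation : dihedral n := (1%R, false).
Definition reflection : dihedral n := (0%R, true).

Lemma card_dihedralT : #|{: dihedral n}| = (2 * n)%N.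
Proof. by rewrite card_prod card_bool card_ord Zp_cast // mulnC. Qed.

Lemma rotationX m : rotation ^+ m = (m%:R%R, false) :> dihedral n.
Proof.
elim: m => [|m IHm]; first by [].
by rewrite expgSr IHm mulrSr.
Qed.

Lemma order_rotation : #[rotation] = n.
Proof.
have rotn m : (rotation ^+ m == 1) = (n %| m).
  rewrite rotationX -[1]/(0%R, false) xpair_eqE andbT /=.
  by rewrite -(inj_eq val_inj) /= val_Zp_nat.
apply/eqP; rewrite eqn_dvd order_dvdn rotn dvdnn /=.
by rewrite -rotn expg_order.
Qed.

Lemma order_reflection : #[reflection] = 2.
Proof.
apply: nt_prime_order => //; rewrite expg2.
by congr (_, _); rewrite /= subr0.
Qed.

Lemma rotation_reflection : rotation ^ reflection = rotation^-1.
Proof.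
have V : reflection^-1 = reflection by apply: involutionV order_reflection.
rewrite conjgE V; congr (_, _).
by rewrite /= add0r addr0.
Qed.

Lemma dihedralE (g : dihedral n) : g = rotation ^+ g.1 * reflection ^+ g.2.
Proof.
case: g => i e; rewrite rotationX /= natr_Zp.
case: e; rewrite /= ?expg0 ?mulg1 //.
by congr (_, _); rewrite /= addr0.
Qed.

Section Lift.
Variables (H : groupType) (a t : H).
Hypotheses (an : a ^+ n = 1) (t2 : t ^+ 2 = 1) (at_ : a ^ t = a^-1).

Definition dihedral_lift (g : dihedral n) : H := a ^+ g.1 * t ^+ g.2.

Lemma dihedral_lift_rotation : dihedral_lift rotation = a.
Proof. by rewrite /dihedral_lift mulg1 /= /rotation /= Zp_cast // modn_small. Qed.

Lemma dihedral_lift_reflection : dihedral_lift reflection = t.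
Proof. by rewrite /dihedral_lift mul1g. Qed.

Let expD (i j : 'Z_n) : a ^+ (i + j)%R = a ^+ i * a ^+ j.
Proof.
have -> : (i + j)%R = ((i + j) %% n)%N :> nat by congr modn; exact: Zp_cast.
rewrite -expgD [in RHS](divn_eq (i + j) n) expgD mulnC expgM an.
by rewrite expg1n mul1g.
Qed.

(** The universal property of the dihedral group. *)
Lemma dihedral_liftM : {morph dihedral_lift : g h / g * h}.
Proof.
have tV : t^-1 = t by rewrite -[LHS]mulg1 -t2 expg2 mulKg.
have ta m : t * a ^+ m = (a ^+ m)^-1 * t.
  by rewrite -expgVn -at_ -conjXg conjgE tV -!mulgA -expg2 t2 mulg1.
have expN (i j : 'Z_n) : a ^+ (i - j)%R = a ^+ i * (a ^+ j)^-1.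
  by apply: (canRL (mulgK _)); rewrite -expD subrK.
move=> [i e] [j d]; rewrite /dihedral_lift /=.
case: e d => [] [] /=; rewrite ?expg1 ?expg0 ?mulg1 ?expD ?expN ?mulgA //.
- by rewrite -(mulgA _ t) ta !mulgA -(mulgA _ t t) -expg2 t2 mulg1.
- by rewrite -(mulgA _ t) ta !mulgA.
Qed.
End Lift.
End DihedralTheory.

(** * Existence *)

Section DirectProduct.
Variables gT1 gT2 : finGroupType.

Lemma pair_expg (a : gT1) (b : gT2) m : (a, b) ^+ m = (a ^+ m, b ^+ m).
Proof. by elim: m => // m IHm; rewrite !expgS IHm. Qed.

Lemma pair_invg (a : gT1) (b : gT2) : (a, b)^-1 = (a^-1, b^-1).
Proof. by []. Qed.

Lemma pair_conjg (a c : gT1) (b d : gT2) : (a, b) ^ (c, d) = (a ^ c, b ^ d).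
Proof. by []. Qed.

Lemma order_pair (a : gT1) (b : gT2) : #[(a, b)] = lcmn #[a] #[b].
Proof.
have dv m : (#[(a, b)] %| m) = (lcmn #[a] #[b] %| m).
  by rewrite order_dvdn dvdn_lcm !order_dvdn pair_expg -xpair_eqE.
by apply/eqP; rewrite eqn_dvd dv dvdnn -dv dvdnn.
Qed.
End DirectProduct.

Lemma isog_cycles_setX (gT : finGroupType) (K : {group gT}) (a b : gT) :
  <[a]> \x <[b]> = K -> K \isog setX (Zp #[a]) (Zp #[b]).
Proof.
move=> defK.
apply: (isog_dprod (L := setX_group (Zp_group #[a]) (Zp_group #[b])) defK
          (setX_dprod (Zp_group _) (Zp_group _))).
- apply: (isog_trans (H := Zp_group #[a])); first by rewrite isog_sym Zp_isog.
  have := sub_isog (subsetT (Zp_group #[a])) (injm_pairg1 _ 'Z_#[b]).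
  by rewrite morphim_pairg1.
- apply: (isog_trans (H := Zp_group #[b])); first by rewrite isog_sym Zp_isog.
  have := sub_isog (subsetT (Zp_group #[b])) (injm_pair1g 'Z_#[a] _).
  by rewrite morphim_pair1g.
Qed.

(** The presented group: r0 r2 = (t, 1) inverts x = (a, 1) and centralizes y,
    while r0 = (1, t) centralizes x and inverts y. *)
Section Model.
Variables n k : nat.
Hypotheses (n_gt1 : 1 < n) (k_gt1 : 1 < k).
Hypotheses (oddn : odd n) (oddk : odd k).

Let gT := (dihedral n * dihedral k)%type.
Let x : gT := (rotation n, 1).
Let y : gT := (1, rotation k).
Let r0 : gT := (1, reflection k).
Let r2 : gT := (reflection n, reflection k).
Let r1 : gT := x * y * r2.

Let ox : #[x] = n. Proof. by rewrite order_pair order1 lcmn1 order_rotation. Qed.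
Let oy : #[y] = k. Proof. by rewrite order_pair order1 lcm1n order_rotation. Qed.
Let or0 : #[r0] = 2.
Proof. by rewrite order_pair order1 lcm1n order_reflection. Qed.
Let or2 : #[r2] = 2. Proof. by rewrite order_pair !order_reflection. Qed.
Let r1E : r1 = (rotation n * reflection n, rotation k * reflection k).
Proof. by congr (_, _); rewrite /= ?mulg1 ?mul1g. Qed.
Let r12 : r1 * r2 = (rotation n, rotation k).
Proof.
rewrite /r1 -mulgA (involution_sqr or2) mulg1.
by congr (_, _); rewrite /= ?mulg1 ?mul1g.
Qed.
Let order_rotation_reflection l : 1 < l -> #[rotation l * reflection l] = 2.
Proof.
move=> l_gt1; apply: nt_prime_order => //.
rewrite expg2; congr (_, _).
by rewrite /= addr0 subrr.
Qed.
Let or1 : #[r1] = 2.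
Proof. by rewrite r1E order_pair !order_rotation_reflection. Qed.
Let r01 : r0 * r1 = (rotation n * reflection n, (rotation k)^-1).
Proof.
rewrite r1E; congr (_, _); first exact: mul1g.
have := rotation_reflection k; rewrite conjgE.
by rewrite (involutionV (order_reflection k)) => <-.
Qed.
Let crr : r0 * r2 = r2 * r0.
Proof. by congr (_, _); rewrite /= ?mulg1 ?mul1g. Qed.
Let r02 : r0 * r2 = (reflection n, 1).
Proof.
by congr (_, _); [exact: mul1g | exact: involution_sqr (order_reflection k)].
Qed.
Let rels : relations n k x y r0 r2.
Proof.
split; [split | split; [split | split]].
- by apply/eqP; rewrite -order_dvdn ox.
- by apply/eqP; rewrite -order_dvdn oy.
- by apply/eqP; rewrite -order_dvdn or0.
- by apply/eqP; rewrite -order_dvdn or2.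
- by apply/eqP/commgP; congr (_, _); rewrite /= ?mulg1 ?mul1g.
- by apply/eqP/commgP.
- by rewrite /x /r0 pair_conjg conjg1 conj1g.
- by rewrite /x /r2 pair_conjg pair_invg rotation_reflection conj1g invg1.
- by rewrite /y /r0 pair_conjg pair_invg rotation_reflection conj1g invg1.
- by rewrite /y /r2 pair_conjg pair_invg rotation_reflection conj1g invg1.
Qed.

Let full (A : {group gT}) : x \in A -> y \in A -> r0 \in A -> r2 \in A ->
  A = [set: gT] :> {set gT}.
Proof.
move=> Ax Ay A0 A2; apply/setP=> -[g h]; rewrite inE.
have -> : (g, h) = x ^+ g.1 * (r0 * r2) ^+ g.2 * y ^+ h.1 * r0 ^+ h.2.
  rewrite r02 !pair_expg; congr (_, _) => /=.
    by rewrite !expg1n !mulg1 -dihedralE.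
  by rewrite !expg1n !mul1g -dihedralE.
by rewrite !groupM ?groupX ?groupM.
Qed.

Let genxy : <<[set x; y; r0; r2]>> = [set: gT].
Proof. by apply: full; rewrite mem_gen // !inE eqxx ?orbT. Qed.

Let genr : <<[set r0; r1; r2]>> = [set: gT].
Proof.
pose A := <<[set r0; r1; r2]>>%G.
have A0 : r0 \in A by rewrite mem_gen // !inE eqxx.
have A1 : r1 \in A by rewrite mem_gen // !inE eqxx ?orbT.
have A2 : r2 \in A by rewrite mem_gen // !inE eqxx ?orbT.
have Ay : y \in A.
  (* k is odd, so y^-1 is a power of its square (r0 r1)^2 *)
  rewrite -groupV; apply: odd_sqr_mem; first by rewrite orderV oy.
  have -> : y^-1 ^+ 2 = (r0 * r1) ^+ 2.
    have f2 : (rotation n * reflection n) ^+ 2 = 1.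
      by apply/eqP; rewrite -order_dvdn order_rotation_reflection.
    by rewrite r01 /y pair_invg !pair_expg f2 invg1 expg1n.
  exact: groupX 2 (groupM A0 A1).
have Ax : x \in A.
  have -> : x = r1 * r2 * y^-1.
    by rewrite r12; congr (_, _); rewrite /= ?invg1 ?mulg1 ?mulgV.
  by rewrite groupM ?groupV // (groupM A1 A2).
exact: (@full A).
Qed.

Let cardG : #|[set: gT]| = (4 * (n * k))%N.
Proof. by rewrite cardsT card_prod !card_dihedralT //; lia. Qed.

Let K := (<[x]> <*> <[y]>)%G.
Let defK : <[x]> \x <[y]> = K.
Proof.
apply: dprodEY.
  rewrite cycle_subG /= cent_cycle; apply/cent1P.
  by congr (_, _); rewrite /= ?mulg1 ?mul1g.
apply/trivgP/subsetP=> g /setIP[/cycleP[i ->] /cycleP[j]].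
rewrite !pair_expg => -[-> _]; rewrite !expg1n.
by rewrite inE.
Qed.

Let cardK : #|K| = (n * k)%N.
Proof. by rewrite -(dprod_card defK) -!orderE ox oy. Qed.

Let D := <<[set r0; r2]>>%G.
Let dprodD : <[r0]> \x <[r2]> = D.
Proof.
have -> : D = <[r0]> <*> <[r2]> :> {set gT} by rewrite joing_idl joing_idr.
apply: dprodEY.
  by rewrite cycle_subG /= cent_cycle; apply/cent1P.
apply/trivgP; rewrite /= (cycle2g or0) (cycle2g or2).
apply/subsetP=> g; rewrite !inE => /andP[/orP[//|/eqP->]].
by rewrite (negPf (involution_neq1 or0)).
Qed.
Let cardD : #|D| = 4.
Proof. by rewrite -(dprod_card dprodD) -!orderE or0 or2. Qed.

Let sdprodG : (<[x]> \x <[y]>) ><| D = [set: gT].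
Proof.
have [_ [_ [x0 x2 y0 y2]]] := rels.
have Kx : x \in K by rewrite mem_gen // inE cycle_id.
have Ky : y \in K by rewrite mem_gen // inE cycle_id orbT.
have nK r : x ^ r \in K -> y ^ r \in K -> r \in 'N(K).
  move=> xr yr; rewrite inE /= -genJ conjUg -!cycleJ gen_subG subUset.
  by rewrite !cycle_subG xr yr.
have nKD : D \subset 'N(K).
  by rewrite gen_subG subUset !sub1set !nK ?x0 ?x2 ?y0 ?y2 ?groupV.
have tiKD : K :&: D = 1.
  apply: coprime_TIg; rewrite cardK cardD (coprimeXr 2 (n := 2)) //.
  by rewrite coprimen2 oddM oddn.
rewrite defK sdprodE //; apply/eqP.
by rewrite eqEcard subsetT /= cardG (TI_cardMg tiKD) cardK cardD [leqRHS]mulnC.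
Qed.

Let isogK : K \isog setX (Zp k) (Zp n).
Proof.
have defK' : <[y]> \x <[x]> = K by rewrite dprodC.
by have := isog_cycles_setX defK'; rewrite oy ox.
Qed.

Let isogD : D \isog setX (Zp 2) (Zp 2).
Proof. by have := isog_cycles_setX dprodD; rewrite or0 or2. Qed.

(** An element ((i, e), (j, d)) of the model is x^i (r0 r2)^e y^j r0^d.  The two
    dihedral lifts have commuting images, so their product is a morphism. *)
Let presentedG : presented n k [set: gT] x y r0 r2.
Proof.
split=> // H x' y' s0 s2 [[xn yk s02 s22] [[cxy cs] [x0 x2 y0 y2]]].
have {}cxy : commute x' y' by apply/commgP/eqP.
pose f1 := @dihedral_lift n H x' (s0 * s2); pose f2 := @dihedral_lift k H y' s0.
have cs' : commute s0 s2 by apply/commgP/eqP.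
have f1M : {morph f1 : g h / g * h}.
  apply: dihedral_liftM => //; first by rewrite expgMn // s02 s22 mulg1.
  by rewrite conjgM x0.
have f2M : {morph f2 : g h / g * h} by apply: dihedral_liftM.
have fixC (a b : H) : a ^ b = a -> commute a b.
  by move=> ab; apply/commgP; rewrite commgEl ab mulVg.
have cf g h : commute (f1 g) (f2 h).
  have cxs0 : commute x' s0 by apply: fixC.
  have cys : commute y' (s0 * s2).
    by apply: fixC; rewrite conjgM y0 conjVg y2 invgK.
  have cs0 : commute s0 (s0 * s2) by apply: commuteM.
  by apply: commuteM; apply: commute_sym; apply: commuteM;
    apply: commuteX2 => //; apply: commute_sym.
exists (fun g : gT => f1 g.1 * f2 g.2); split.
  move=> [g h] [g' h'] _ _ /=; rewrite f1M f2M.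
  have mM (a a' b b' : H) :
      commute a' b -> a * a' * (b * b') = a * b * (a' * b').
    by move=> ab; rewrite !mulgA -(mulgA a) ab !mulgA.
  exact: mM.
split; rewrite /f1 /f2 /=.
- by rewrite dihedral_lift_rotation // {1}/dihedral_lift !mulg1.
- by rewrite dihedral_lift_rotation // {1}/dihedral_lift !mul1g.
- by rewrite dihedral_lift_reflection // {1}/dihedral_lift !mul1g.
- by rewrite !dihedral_lift_reflection // cs' -mulgA -expg2 s02 mulg1.
Qed.

Hypothesis dvd_kn : k %| n.

(** Reduction modulo k, which exists because k divides n. *)
Let pi := @dihedral_lift n (dihedral k) (rotation k) (reflection k).
Let piM : {morph pi : g h / g * h}.
Proof.
apply: dihedral_liftM => //; last exact: rotation_reflection.
  by apply/eqP; rewrite -order_dvdn order_rotation.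
by apply/eqP; rewrite -order_dvdn order_reflection.
Qed.

(** <r1, r2> lies in the graph of pi, and the first components of <r0, r1> lie in
    {1, a t}; the graph has one point over 1, the identity, and one over a t,
    which is r1. *)
Let stringG : string_C_group [set: gT] r0 r1 r2.
Proof.
have pi_rot : pi (rotation n) = rotation k by apply: dihedral_lift_rotation.
have pi_refl : pi (reflection n) = reflection k.
  exact: dihedral_lift_reflection.
apply/string_C_groupE; split=> //.
pose graph g : gT := (g, pi g).
have graphM : {in [set: dihedral n] &, {morph graph : g h / g * h}}.
  by move=> g h _ _; rewrite /graph piM.
have sG : <<[set r1; r2]>> \subset Morphism graphM @* setT.
  rewrite gen_subG subUset !sub1set.
  have <- : graph (rotation n * reflection n) = r1.
    by rewrite /graph piM pi_rot pi_refl r1E.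
  have <- : graph (reflection n) = r2 by rewrite /graph pi_refl.
  by rewrite !(mem_morphim (Morphism graphM)) ?inE.
have sX : <<[set r0; r1]>> \subset setX <[rotation n * reflection n]> setT.
  by rewrite gen_subG subUset !sub1set r1E !inE /= cycle_id group1.
apply/subsetP=> g /setIP[/(subsetP sX) + /(subsetP sG)/morphimP[a _ _ gE]].
rewrite gE inE /= (cycle2g (order_rotation_reflection n_gt1)) !inE andbT.
case/orP=> /eqP->; last by rewrite /graph piM pi_rot pi_refl -r1E cycle_id.
by rewrite (_ : graph 1 = 1) ?group1 // /graph /pi /dihedral_lift mulg1.
Qed.

Let type01 : #[r0 * r1] = (2 * k)%N.
Proof.
have /eqP c2k : coprime 2 k by rewrite coprime2n.
rewrite r01 order_pair orderV order_rotation_reflection // order_rotation //.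
by rewrite -muln_lcm_gcd c2k muln1.
Qed.

Let type12 : #[r1 * r2] = n.
Proof. by rewrite r12 order_pair !order_rotation //; apply/lcmn_idPl. Qed.

Lemma model_string_C_group :
  exists (T : finGroupType) (G : {group T}) (x y r0 r1 r2 : T),
    [/\ string_C_group G r0 r1 r2,
        #|G| = (4 * (n * k))%N &
        schlafli_type r0 r1 r2 = ((2 * k)%N, n)]
    /\
    [/\ r1 = x * y * r2,
        (<[x]> \x <[y]>) ><| <<[set r0; r2]>> = G,
        presented n k G x y r0 r2,
        <[x]> <*> <[y]> \isog setX (Zp k) (Zp n) &
        <<[set r0; r2]>> \isog setX (Zp 2) (Zp 2)].
Proof.
exists gT, [set: gT]%G, x, y, r0, r1, r2; split.
  by split; rewrite /schlafli_type ?type01 ?type12.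
by split.
Qed.
End Model.

(** * The classification *)

Theorem theorem1p2 (m p : nat) (hm : 2 <= m) (hp : prime p) (hodd : odd p) :
  (forall (gT : finGroupType) (G P : {group gT}) (r0 r1 r2 : gT),
     string_C_group G r0 r1 r2 ->
     non_degenerate r0 r1 r2 ->
     #|G| = (4 * p ^ m)%N ->
     p.-Sylow(G) P ->
     abelian P <-> tight G r0 r1 r2)
  /\
  (forall l1 l2 : nat, 1 <= l1 -> l1 <= l2 -> (l1 + l2)%N = m ->
     exists (gT : finGroupType) (G : {group gT}) (x y r0 r1 r2 : gT),
       [/\ string_C_group G r0 r1 r2,
           #|G| = (4 * p ^ m)%N &
           schlafli_type r0 r1 r2 = ((2 * p ^ l1)%N, (p ^ l2)%N)]
       /\
       [/\ r1 = x * y * r2,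
           (<[x]> \x <[y]>) ><| <<[set r0; r2]>> = G,
           presented (p ^ l2) (p ^ l1) G x y r0 r2,
           <[x]> <*> <[y]> \isog setX (Zp (p ^ l1)) (Zp (p ^ l2)) &
           <<[set r0; r2]>> \isog setX (Zp 2) (Zp 2)]
       /\
       (forall (rT : finGroupType) (H : {group rT}) (s0 s1 s2 : rT),
          string_C_group H s0 s1 s2 ->
          #|H| = (4 * p ^ m)%N ->
          schlafli_type s0 s1 s2 = ((2 * p ^ l1)%N, (p ^ l2)%N) \/
          schlafli_type s0 s1 s2 = ((p ^ l2)%N, (2 * p ^ l1)%N) ->
          scg_iso H s0 s1 s2 G r0 r1 r2 \/ scg_iso H s0 s1 s2 G r2 r1 r0)).
Proof.
split=> [gT G P r0 r1 r2 scg _ oG sylP | l1 l2 l1_gt0 le_l lm].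
  have [oddP nilP sPG oGP] := Sylow_index4 hp hodd oG sylP.
  exact: odd_index4_abelian_tight scg oddP nilP sPG oGP.
have gt1 l : 0 < l -> 1 < p ^ l.
  by move=> l_gt0; rewrite -{1}(exp1n l) ltn_exp2r // prime_gt1.
have oddX l : odd (p ^ l) by rewrite oddX hodd orbT.
have [gT [G [x [y [r0 [r1 [r2 [scG model]]]]]]]] :=
  model_string_C_group (gt1 l2 (leq_trans l1_gt0 le_l)) (gt1 l1 l1_gt0)
    (oddX l2) (oddX l1) (dvdn_exp2l p le_l).
have pE : (p ^ l2 * p ^ l1 = p ^ m)%N by rewrite -expnD addnC lm.
rewrite pE in scG.
exists gT, G, x, y, r0, r1, r2; split=> //; split=> // rT H s0 s1 s2 scH oH.
have [scg oG typeG] := scG; have [def_r1 _ presG _ _] := model.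
have Gr1 : r1 \in G.
  by have [_ _ <- _ _] := scg; rewrite mem_gen // !inE eqxx orbT.
have unique (t0 t1 t2 : rT) : string_C_group H t0 t1 t2 ->
    schlafli_type t0 t1 t2 = ((2 * p ^ l1)%N, (p ^ l2)%N) ->
  scg_iso H t0 t1 t2 G r0 r1 r2.
  move=> scgt typet; have [_ _ genH _ _] := scgt.
  have [x' [y' [rel def1]]] := tight_type_relations hp hodd lm scgt oH typet.
  by apply: presented_scg_iso presG def_r1 Gr1 _ rel def1 genH; rewrite oG.
case=> typeH; first by left; apply: unique.
right; have [f [isof [f0 f1 f2]]] : scg_iso H s2 s1 s0 G r0 r1 r2.
  apply: unique; first exact: string_C_group_dual.
  have [_ [o0 o1 o2] _ _ _] := scH.
  have [k1 k2] := typeH; rewrite /schlafli_type -k1 -k2.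
  by rewrite -(orderV (s2 * s1)) -(orderV (s1 * s0)) !invMg !involutionV.
by exists f.
Qed.
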